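(* Let ${\bf p}=(p_1,p_2,\dots)$ and ${\bf q}=(q_1,q_2,\dots)$ be given by $p_k=2(-1)^{k-1}\phi(2k)$ and $q_k=2(-1)^{k-1}\zeta(2k)$. Then for every integer $s\ge1$, \[\theta(2s+2)=2\sum_{k=0}^{s-1}\phi(2s-2k)\theta(2k+2)=\frac{(-1)^s\pi^2}{8}\Delta_s({\bf p})=\frac{\pi^2}{8}\sum_{t=1}^{s}\ \sum_{\substack{d_1,\dots,d_s\ge0\\ d_1+\dots+d_s=t\\ d_1+2d_2+\dots+sd_s=s}}2^t\binom{t}{d_1,\dots,d_s}\phi(2)^{d_1}\phi(4)^{d_2}\cdots\phi(2s)^{d_s},\] and \[\zeta(2s+2)=\frac{2}{2^{2s+2}-1}\sum_{k=0}^{s-1}(2^{2k+2}-1)\zeta(2s-2k)\zeta(2k+2)=\frac{(-1)^s\pi^2}{2(2^{2s+2}-1)}\Delta_s({\bf q})\] \[=\frac{\pi^2/2}{2^{2s+2}-1}\sum_{t=1}^{s}\ \sum_{\substack{d_1,\dots,d_s\ge0\\ d_1+\dots+d_s=t\\ d_1+2d_2+\dots+sd_s=s}}2^t\binom{t}{d_1,\dots,d_s}\zeta(2)^{d_1}\zeta(4)^{d_2}\cdots\zeta(2s)^{d_s}.\]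
   Context: $\zeta(s)=\sum_{n\ge1}n^{-s}$, $\theta(s)=(1-2^{-s})\zeta(s)$, $\phi(s)=2^{-s}\zeta(s)$. For a sequence ${\bf h}=(h_1,h_2,\dots)$ and $s\ge1$, $\Delta_s({\bf h})=(-1)^s\det(a_{ij})_{1\le i,j\le s}$ where $a_{ij}=h_{i-j+1}$ if $j\le i$, $a_{ij}=1$ if $j=i+1$, and $a_{ij}=0$ if $j>i+1$ (a lower Hessenberg Toeplitz matrix with $h_1$ on the diagonal and $1$'s on the superdiagonal). $\binom{t}{d_1,\dots,d_s}=t!/(d_1!\cdots d_s!)$ is the multinomial coefficient. *)

(* Defs.v *)
From mathcomp Require Export all_boot all_order all_algebra.
From mathcomp Require Export all_classical all_reals all_analysis.

Set Implicit Arguments.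
Unset Strict Implicit.
Unset Printing Implicit Defensive.

Import Order.TTheory GRing.Theory Num.Theory.
Import numFieldNormedType.Exports.

Local Open Scope ring_scope.
Local Open Scope classical_set_scope.

(* As the limit of a divergent sequence is a default value,
   this is the zeta function only for s > 1. *)
Definition zeta (R : realType) (s : R) : R :=
  limn (fun N : nat => \sum_(1 <= n < N.+1) (n%:R : R) `^ (- s)).

Definition theta (R : realType) (s : R) : R := (1 - 2 `^ (- s)) * zeta s.

Definition phi (R : realType) (s : R) : R := 2 `^ (- s) * zeta s.

(* Rows and columns are numbered from 0 here, which does not affect the
   difference i - j; the sequence is h 1, h 2, ... and h 0 is never used. *)
Definition hessenberg (R : realType) (s : nat) (h : nat -> R) : 'M[R]_s :=
  \matrix_(i < s, j < s)
    if (j <= i)%N then h (i - j + 1)%N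
    else if (j == i + 1 :> nat)%N then 1 else 0.

Definition Delta (R : realType) (s : nat) (h : nat -> R) : R :=
  (-1) ^+ s * \det (hessenberg s h).

Definition multinom (R : realType) (t s : nat) (d : 'I_s -> nat) : R :=
  (t`!)%:R / \prod_(i < s) ((d i)`!)%:R.

(* The tuples (d_1, ..., d_s) of naturals with d_1 + ... + d_s = t and
   d_1 + 2 d_2 + ... + s d_s = s; d_(i+1) is d i.  Valuing d in 'I_t.+1 loses
   nothing, since the first condition forces every d_i to be at most t. *)
Definition weighted_compositions (s t : nat) : {set {ffun 'I_s -> 'I_t.+1}} :=
  [set d : {ffun 'I_s -> 'I_t.+1} |
    ((\sum_(i < s) d i)%N == t) && ((\sum_(i < s) i.+1 * d i)%N == s)]%SET.

(* Main.v *)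
(** Writing [m] for even and [n] for odd positive integers, the geometric sum gives
      [2 * \sum_(k < s) m ^- (2 (s - k)) * n ^- (2 (k + 1)) =
         2 (m ^- (2 s) - n ^- (2 s)) / (n ^ 2 - m ^ 2)].
    Summing over [m] and [n], each inner sum of [2 / (n ^ 2 - m ^ 2)] telescopes: over
    [n] it tends to [0], over [m] to [- 1 / n ^ 2], which yields the convolution formula
    for theta.  Bounding the error of truncating both sums at the same [N] by [O(1 / N)]
    avoids exchanging the conditionally convergent double sum.
    The initial value [theta 2 = pi ^ 2 / 8] comes from iterating
    [1 / sin x ^ 2 = (1 / sin (x / 2) ^ 2 + 1 / sin (pi / 2 - x / 2) ^ 2) / 4] from
    [x = pi / 4], together with [1 / sin x ^ 2 - 1 <= 1 / x ^ 2 <= 1 / sin x ^ 2].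
    The determinant and the sum over compositions both solve the resulting renewal
    recurrence, the latter because it is the coefficient of ['X^s] in the geometric
    series of [\sum_i 2 a_i 'X^i].  As [(2 ^ n - 1) zeta n = 2 ^ n theta n], the zeta
    identities are a rescaling of those for theta. *)
Require Import Defs.
From mathcomp Require Import all_boot all_order all_algebra.
From mathcomp Require Import all_classical all_reals all_analysis.
From mathcomp Require Import ring lra zify.

Set Implicit Arguments.
Unset Strict Implicit.
Unset Printing Implicit Defensive.

Import Order.TTheory GRing.Theory Num.Theory.
Import numFieldNormedType.Exports.

Local Open Scope ring_scope.

(** * Hessenberg determinants *)

(* Generalizing over the first column closes the induction: expanding along the
   first row leaves the same kind of matrix, with the first column shifted. *)
Definition hessenberg_shift (R : realType) (h : nat -> R) (r n : nat) : 'M[R]_n :=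
  \matrix_(i < n, j < n)
    if j == 0%N :> nat then h (i + r)%N else hessenberg n h i j.

Lemma det_hessenberg_shift (R : realType) (h : nat -> R) (n r : nat) :
  \det (hessenberg_shift h r n.+1) =
  \sum_(l < n.+1) (-1) ^+ l * h (r + l)%N * \det (hessenberg (n - l) h).
Proof.
elim: n r => [|n IHn] r.
  by rewrite big_ord1 det_mx11 !mxE /= det_mx00 expr0 mul1r mulr1 addn0 add0n.
rewrite (expand_det_row _ ord0) 2!big_ord_recl big1 ?addr0; last first.
  by move=> i _; rewrite !mxE /= mul0r.
rewrite !mxE /= add0n [RHS]big_ord_recl expr0 mul1r addn0 subn0; congr (_ + _).
  congr (_ * _); rewrite /cofactor expr0 mul1r.
  congr (\det _); apply/matrixP => i j.
  by rewrite !mxE /= /bump /= !add1n ltnS subSS addSn eqSS.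
rewrite mul1r /cofactor /= expr1 mulN1r.
have -> : row' ord0 (col' (lift ord0 ord0) (hessenberg_shift h r n.+2)) =
          hessenberg_shift h r.+1 n.+1.
  apply/matrixP => i j; rewrite !mxE /=.
  by case: j => -[|j] lt_j; rewrite /= /bump /= ?add0n ?add1n ?addn0 ?addnS.
rewrite IHn -sumrN; apply: eq_bigr => l _.
by rewrite /= /bump /= add1n subSS addSnnS exprS mulN1r !mulNr.
Qed.

Lemma det_hessenberg_rec (R : realType) (h : nat -> R) (n : nat) :
  \det (hessenberg n.+1 h) =
  \sum_(l < n.+1) (-1) ^+ l * h l.+1 * \det (hessenberg (n - l) h).
Proof.
rewrite -(det_hessenberg_shift h n 1); congr (\det _).
by apply/matrixP => i [[|j] lt_j]; rewrite !mxE /= ?subn0.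
Qed.

Lemma Delta_rec (R : realType) (h : nat -> R) (n : nat) :
  Delta n.+1 h = - \sum_(l < n.+1) h l.+1 * Delta (n - l) h.
Proof.
rewrite /Delta det_hessenberg_rec mulr_sumr -sumrN; apply: eq_bigr => l _.
have le_ln : (l <= n)%N by rewrite -ltnS.
have -> : (-1) ^+ n.+1 = - ((-1) ^+ (n - l) * (-1) ^+ l) :> R.
  by rewrite -exprD subnK // exprS mulN1r.
have e : (-1) ^+ l * (-1) ^+ l = 1 :> R by rewrite -exprMn mulrNN mulr1 expr1n.
move: e; set x := (-1) ^+ (n - l); set y := (-1) ^+ l => e.
by transitivity (- (y * y * (h l.+1 * (x * \det (hessenberg (n - l) h)))));
  [ring | rewrite e mul1r].
Qed.

(** * The sum over compositions *)

(** The exponential series of [x * 'X], cut after degree [B]; it carries the multinomial theorem as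
    the rule that exponentials multiply. *)
Definition exp_trunc (F : numFieldType) (A : comAlgType F) (B : nat) (x : A) :
    {poly A} := \poly_(k < B.+1) ((k`!)%:R^-1 *: x ^+ k).

(** A product of exponentials is the exponential of the sum, and the truncation is invisible up to
    degree [B]. Each new factor is absorbed by the binomial formula. *)
Lemma coef_prod_exp_trunc (F : numFieldType) (A : comAlgType F) (B s : nat)
    (x : 'I_s -> A) (t : nat) : (t <= B)%N ->
  (\prod_(i < s) exp_trunc B (x i))`_t = (t`!)%:R^-1 *: (\sum_(i < s) x i) ^+ t.
Proof.
elim: s x t => [|s IHs] x t tB.
  rewrite !big_ord0 coef1 expr0n; case: t tB => [|t] tB /=.
    by rewrite fact0 invr1 scale1r.
  by rewrite scaler0.
rewrite !big_ord_recr /= coefMr exprDn scaler_sumr; apply: eq_bigr => j _.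
have jt : (j <= t)%N by rewrite -ltnS.
rewrite IHs; last exact: leq_trans (leq_subr _ _) tB.
rewrite coef_poly ltnS (leq_trans jt tB) -scalerAl -scalerAr scalerA.
rewrite -[_ *+ 'C(t, j)]scaler_nat scalerA; congr (_ *: _).
rewrite -(bin_fact jt) !natrM; field.
by rewrite !pnatr_eq0 -!lt0n !fact_gt0 bin_gt0 jt.
Qed.

(** Two readings of the coefficient of ['X^t] in a product of exponentials truncated at [t].
    Distributing the product over the sums produces exactly the index functions with values in
    ['I_t.+1]. *)
Lemma multinomial_theorem (F : numFieldType) (A : comAlgType F) (s t : nat)
    (x : 'I_s -> A) :
  (\sum_(i < s) x i) ^+ t =
  \sum_(d : {ffun 'I_s -> 'I_t.+1} | (\sum_(i < s) d i == t)%N)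
    ((t`!)%:R / \prod_(i < s) ((d i)`!)%:R) *: \prod_(i < s) x i ^+ d i.
Proof.
have t0 : (t`!)%:R != 0 :> F by rewrite pnatr_eq0 -lt0n fact_gt0.
apply: (scalerI (a := (t`!)%:R^-1)); first by rewrite invr_eq0.
rewrite -(coef_prod_exp_trunc x (leqnn t)).
have -> : \prod_(i < s) exp_trunc t (x i) =
    \sum_(d : {ffun 'I_s -> 'I_t.+1})
      ((\prod_(i < s) ((d i)`!)%:R)^-1 *: \prod_(i < s) x i ^+ d i)%:P
        * 'X^(\sum_(i < s) d i)%N.
  under eq_bigr do rewrite /exp_trunc poly_def.
  rewrite bigA_distr_bigA; apply: eq_bigr => d _ /=.
  rewrite mul_polyC -prodfV -scaler_prod -prodrXr /=.
  by rewrite scaler_prod.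
rewrite coef_sum [in RHS]big_mkcond scaler_sumr; apply: eq_bigr => d _.
rewrite coefCM coefXn eq_sym; case: eqP => _ /=; last by rewrite mulr0 scaler0.
by rewrite mulr1 scalerA mulKf.
Qed.

(* [\sum_(t < s.+1) A ^+ t] inverts [1 - A] modulo ['X^s.+1]. *)
Lemma coef_sum_exp_rec (F : comNzRingType) (A : {poly F}) (b : nat -> F) (s n : nat) :
  A`_0 = 0 -> b 0%N = 1 -> (n <= s)%N ->
  (forall k, (k < s)%N -> b k.+1 = \sum_(l < k.+1) A`_l.+1 * b (k - l)%N) ->
  (\sum_(t < s.+1) A ^+ t)`_n = b n.
Proof.
move=> A0 b0 ns hb; elim/ltn_ind: n ns => n IHn ns.
have coef_small t k : (k < t)%N -> (A ^+ t)`_k = 0.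
  elim: t k => // t IHt k; rewrite ltnS => kt.
  rewrite exprS coefM big1 // => -[[|i] /= lt_i] _; first by rewrite A0 mul0r.
  by rewrite IHt ?mulr0 //; lia.
have e : \sum_(t < s.+1) A ^+ t =
    1 - A ^+ s.+1 + A * \sum_(t < s.+1) A ^+ t.
  have := subrX1 A s.+1; set S := (\sum_(i < _) _) => h.
  have -> : A ^+ s.+1 = (A - 1) * S + 1 by rewrite -h subrK.
  ring.
rewrite e !coefD coefN coef1 coef_small // subr0 coefM big_ord_recl A0 mul0r add0r.
case: n IHn ns => [|n] IHn ns; first by rewrite big_ord0 addr0 b0.
rewrite add0r hb //; apply: eq_bigr => i _.
by rewrite lift0 /= subSS IHn //; lia.
Qed.

Lemma sum_weighted_compositions (R : realType) (a b : nat -> R) (s : nat) :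
  b 0%N = 1 -> (forall n, b n.+1 = \sum_(l < n.+1) 2 * a l.+1 * b (n - l)%N) ->
  (1 <= s)%N ->
  \sum_(1 <= t < s.+1) \sum_(d in weighted_compositions s t)
     2 ^+ t * multinom R t (fun i : 'I_s => d i) *
     \prod_(i < s) a i.+1 ^+ d i = b s.
Proof.
move=> b0 hb s1.
(* Generating polynomial of [2 * a k], cut at degree [s], since later terms cannot reach ['X^s]. *)
pose A : {poly R} := \sum_(i < s) (a i.+1 *+ 2) *: 'X^(i.+1).
have cA k : A`_k = if (0 < k <= s)%N then 2 * a k else 0.
  rewrite coef_sum; case: ifP => hk.
    have kk : (k.-1 < s)%N by lia.
    rewrite (bigD1 (Ordinal kk)) //= big1 ?addr0.
      by rewrite prednK ?coefZ ?coefXn ?eqxx ?mulr1 ?mulr_natl//; lia.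
    move=> i; rewrite -val_eqE /= => hi.
    by rewrite coefZ coefXn; case: eqP => [?|]; rewrite ?mulr0 //; lia.
  rewrite big1 // => i _; rewrite coefZ coefXn; case: eqP => [?|]; rewrite ?mulr0 //.
  by have := ltn_ord i; lia.
rewrite -(coef_sum_exp_rec (A := A) _ b0 (leqnn s)); last 2 first.
- by rewrite cA.
- move=> k ks; rewrite hb; apply: eq_bigr => l _; rewrite cA ifT //.
  by have := ltn_ord l; lia.
(* The power [t = 0] is the constant 1, which has no coefficient at ['X^s] because [s] is positive;
   hence the sum over [t] starts at 1. *)
rewrite -(big_mkord xpredT (fun t => A ^+ t)) big_ltn // coefD expr0 coef1.
rewrite gtn_eqF // add0r coef_sum; apply: eq_bigr => t _.
rewrite /A multinomial_theorem coef_sum.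
rewrite [RHS]big_mkcond [LHS]big_mkcond; apply: eq_bigr => d _.
rewrite inE; case: eqP => //= sd.
(* The multinomial expansion in [{poly R}] accounts for the condition on the sum of the [d i]; the
   exponent of ['X] now tests the weighted condition. *)
have -> : \prod_(i < s) ((a i.+1 *+ 2) *: 'X^(i.+1)) ^+ d i =
   (2 ^+ t * \prod_(i < s) a i.+1 ^+ d i) *: 'X^(\sum_(i < s) i.+1 * d i)%N :> {poly R}.
  under eq_bigr do rewrite exprZn -exprM -mulr_natl exprMn.
  by rewrite scaler_prod big_split /= prodrXr sd prodrXr.
rewrite !coefZ coefXn eq_sym; case: eqP => _; last by rewrite !mulr0.
by rewrite /multinom /= !mulr1 [RHS]mulrCA [RHS]mulrA.
Qed.

(** * Truncated convolution of even and odd power sums *)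

(* Partial fractions: [2 a / (m ^ 2 - a ^ 2)] summed over the [N] first terms
   [m = 2 j + c].  As [N] grows this tends to [(c - 1) / a] when [c = 1], [a] is
   even or [c = 2], [a] is odd. *)
Definition pf_sum (R : realType) (c : R) (N : nat) (a : R) : R :=
  \sum_(j < N) ((2 * j%:R + c - a)^-1 - (2 * j%:R + c + a)^-1).

(** Replacing [a] by [a + 2] shifts both families of fractions by one index, in opposite directions,
    so only terms at the two ends change. *)
Lemma pf_sum_step (R : realType) (c : R) (N : nat) (a : R) :
  pf_sum c N (a + 2) = pf_sum c N a + ((c - a - 2)^-1 + (c + a)^-1)
     - ((2 * N%:R + c - a - 2)^-1 + (2 * N%:R + c + a)^-1).
Proof.
elim: N => [|N IHN]; first by rewrite /pf_sum !big_ord0 mulr0 !add0r subrr.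
rewrite /pf_sum !big_ord_recr /= -!/(pf_sum _ _ _) IHN -(@natr1 R N).
have -> : 2 * (N%:R + 1) + c - a - 2 = 2 * N%:R + c - a by ring.
have -> : 2 * (N%:R + 1) + c + a = 2 * N%:R + c + (a + 2) by ring.
have -> : 2 * N%:R + c - (a + 2) = 2 * N%:R + c - a - 2 by ring.
ring.
Qed.

(** The limit moves by the two end terms at [j = 0], while each of the two end terms at [N] is at
    most the inverse of the new denominator; this raises the numerator of the error from [a] to
    [a + 2]. *)
Lemma pf_sum_bound_step (R : realType) (c : R) (N : nat) (a l l' : R) :
  0 <= c -> 0 <= a -> a + 2 < 2 * N%:R + c ->
  l' = l + ((c - a - 2)^-1 + (c + a)^-1) ->
  `|pf_sum c N a - l| <= a / (2 * N%:R + c - a) ->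
  `|pf_sum c N (a + 2) - l'| <= (a + 2) / (2 * N%:R + c - (a + 2)).
Proof.
move=> c0 a0 aN -> IH; rewrite pf_sum_step.
set D := 2 * N%:R + c - (a + 2).
have D0 : 0 < D by rewrite /D; lra.
have N0 : 0 <= N%:R :> R by [].
have -> : 2 * N%:R + c - a - 2 = D by rewrite /D; ring.
have leD x : D <= x -> x^-1 <= D^-1 by move=> Dx; rewrite lef_pV2 // posrE; lra.
have h1 : (2 * N%:R + c + a)^-1 <= D^-1 by apply: leD; rewrite /D; lra.
have h10 : 0 <= (2 * N%:R + c + a)^-1 by rewrite invr_ge0; lra.
have h2 : a / (2 * N%:R + c - a) <= a / D.
  by rewrite ler_wpM2l // leD // /D; lra.
have D0' : 0 <= D^-1 by rewrite invr_ge0 ltW.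
rewrite [X in _ <= X](mulrDl a 2).
move: IH h2; set u := a / D; set v := a / _ => IH h2.
move: IH; rewrite !ler_norml => /andP[I1 I2]; apply/andP; split; lra.
Qed.

(** At [a = 0] all terms cancel, and for [c = 1] the end terms at [j = 0] are opposite, so the limit
    stays 0. *)
Lemma pf_sum_odd_bound (R : realType) (N i : nat) : (i <= N)%N ->
  `|pf_sum (1 : R) N (2 * i%:R)| <= (2 * i%:R) / (2 * N%:R + 1 - 2 * i%:R).
Proof.
elim: i => [|i IHi] iN.
  rewrite mulr0 mul0r /pf_sum big1 ?normr0 // => j _.
  by rewrite subr0 addr0 subrr.
have -> : 2 * i.+1%:R = 2 * i%:R + 2 :> R by rewrite -(@natr1 R i); ring.
rewrite -[pf_sum _ _ _]subr0; apply: (@pf_sum_bound_step _ _ _ _ 0) => //.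
- have : i.+1%:R <= N%:R :> R by rewrite ler_nat.
  by rewrite -(@natr1 R i); lra.
- have -> : 1 - 2 * i%:R - 2 = - (1 + 2 * i%:R) :> R by ring.
  by rewrite invrN addNr addr0.
- by rewrite subr0 IHi // ltnW.
Qed.

(** At [a = 1] the sum telescopes to [1 - (2 * N%:R + 1)^-1]; for [c = 2] each step then replaces
    the limit [a^-1] by [(a + 2)^-1]. *)
Lemma pf_sum_even_bound (R : realType) (N i : nat) : (i < N)%N ->
  `|pf_sum (2 : R) N (2 * i%:R + 1) - (2 * i%:R + 1)^-1|
    <= (2 * i%:R + 1) / (2 * N%:R + 2 - (2 * i%:R + 1)).
Proof.
elim: i => [|i IHi] iN.
  rewrite mulr0 add0r.
  have -> : pf_sum (2 : R) N 1 = 1 - (2 * N%:R + 1)^-1.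
    have <- : \sum_(j < N) ((2 * j%:R + 1)^-1 - (2 * j.+1%:R + 1)^-1) =
       1 - (2 * N%:R + 1)^-1 :> R.
      elim: N {iN} => [|N IHN]; first by rewrite big_ord0 mulr0 add0r invr1 subrr.
      by rewrite big_ord_recr /= IHN addrA subrK.
    apply: eq_bigr => j _; congr (_^-1 - _^-1); rewrite -?(@natr1 R j); ring.
  have -> : 2 * N%:R + 2 - 1 = 2 * N%:R + 1 :> R by ring.
  have : 0 <= (2 * N%:R + 1)^-1 :> R by rewrite invr_ge0 addr_ge0 // mulr_ge0.
  by rewrite invr1 mul1r ler_norml => ?; apply/andP; split; lra.
have -> : 2 * i.+1%:R + 1 = 2 * i%:R + 1 + 2 :> R by rewrite -(@natr1 R i); ring.
have i0 : 0 <= i%:R :> R by [].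
apply: (@pf_sum_bound_step _ _ _ _ (2 * i%:R + 1)^-1).
- by [].
- lra.
- have : i.+2%:R <= N%:R :> R by rewrite ler_nat.
  by rewrite -(@natr1 R i.+1) -(@natr1 R i); lra.
- have -> : 2 - (2 * i%:R + 1) - 2 = - (2 * i%:R + 1) :> R by ring.
  rewrite invrN addNKr; congr (_^-1); ring.
- by rewrite IHi // ltnW.
Qed.

Definition odd_sum (R : realType) (m N : nat) : R :=
  \sum_(j < N) (2 * j%:R + 1) ^- m.

Definition even_sum (R : realType) (m N : nat) : R :=
  \sum_(i < N) (2 * i%:R + 2) ^- m.

Lemma pf_term (R : realType) (m n : R) (s : nat) :
  m != 0 -> n != 0 -> n - m != 0 -> n + m != 0 ->
  2 * \sum_(k < s) m ^- (2 * (s - k)) * n ^- (2 * k.+1) =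
  m ^- (2 * s).+1 * ((n - m)^-1 - (n + m)^-1) +
  n ^- (2 * s).+1 * ((m - n)^-1 - (m + n)^-1).
Proof.
move=> m0 n0 nm0 nm1.
have mn0 : m - n != 0 by rewrite -opprB oppr_eq0.
have mn1 : m + n != 0 by rewrite addrC.
pose x := m ^- 2; pose y := n ^- 2.
have xy0 : x - y != 0.
  have -> : x - y = (n - m) * (n + m) * (x * y) by rewrite /x /y; field; rewrite m0 n0.
  by rewrite !mulf_neq0 // invr_eq0 expf_neq0.
(* With [x = m ^- 2] and [y = n ^- 2], multiplying by [x - y] turns the geometric sum into
   [x ^+ s - y ^+ s]. *)
apply: (mulfI xy0).
have -> : (x - y) * (2 * \sum_(k < s) m ^- (2 * (s - k)) * n ^- (2 * k.+1)) =
   2 * (x * y) * (x ^+ s - y ^+ s).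
  rewrite subrXX mulrCA -!mulrA; congr (_ * _).
  rewrite [RHS]mulrA [RHS]mulrCA; congr (_ * _); rewrite mulr_sumr.
  apply: eq_bigr => k _; rewrite !exprM -!exprVn.
  have -> : (s - k = (s.-1 - k).+1)%N by have := ltn_ord k; lia.
  by rewrite /x /y -!exprVn -mulrACA -!exprS.
have mS : m ^- (2 * s).+1 = m^-1 * x ^+ s by rewrite exprS invfM exprM /x exprVn.
have nS : n ^- (2 * s).+1 = n^-1 * y ^+ s by rewrite exprS invfM exprM /y exprVn.
rewrite mS nS; set X := x ^+ s; set Y := y ^+ s; rewrite /x /y.
by field; rewrite ?m0 ?n0 ?nm0 ?nm1 ?mn0 ?mn1.
Qed.

Lemma even_odd_convolution (R : realType) (s N : nat) :
  2 * \sum_(k < s) even_sum R (2 * (s - k)) N * odd_sum R (2 * k.+1) N =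
  \sum_(i < N) (2 * i%:R + 2) ^- (2 * s).+1 * pf_sum 1 N (2 * i%:R + 2) +
  \sum_(j < N) (2 * j%:R + 1) ^- (2 * s).+1 * pf_sum 2 N (2 * j%:R + 1).
Proof.
transitivity (\sum_(i < N) \sum_(j < N) 2 * \sum_(k < s)
   (2 * i%:R + 2) ^- (2 * (s - k)) * (2 * j%:R + 1) ^- (2 * k.+1) : R).
  under [RHS]eq_bigr do rewrite -mulr_sumr exchange_big /=.
  rewrite -mulr_sumr exchange_big /=; congr (_ * _); apply: eq_bigr => k _.
  by rewrite /even_sum /odd_sum big_distrlr.
under eq_bigr => i _.
  under eq_bigr => j _.
    rewrite pf_term; first over.
    - by rewrite gt_eqF // ltr_wpDl // mulr_ge0.
    - by rewrite gt_eqF // ltr_wpDl // mulr_ge0.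
    (* An odd number differs from an even one, so the denominator is nonzero. *)
    - have -> : 2 * j%:R + 1 - (2 * i%:R + 2) = (2 * j + 1)%:R - (2 * i + 2)%:R :> R.
        by rewrite (natrD R (2 * j)) (natrD R (2 * i)) !natrM.
      by rewrite subr_eq0 eqr_nat; apply/eqP; lia.
    - by rewrite gt_eqF // ltr_wpDl ?addr_ge0 ?mulr_ge0 // ltr_wpDl // mulr_ge0.
  rewrite big_split /=; over.
rewrite big_split /=; congr (_ + _).
  by apply: eq_bigr => i _; rewrite mulr_sumr.
by rewrite exchange_big; apply: eq_bigr => i _; rewrite mulr_sumr.
Qed.

(** As [s] is positive, the weighted error is at most [m ^- 2 / (L - m)] with [L = 2 * N%:R + c].
    Splitting this by partial fractions leaves a bound whose sum over [m] is [O(1 / N)]. *)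
Lemma weighted_error_bound (R : realType) (s N : nat) (c m e : R) :
  (0 < s)%N -> (0 < N)%N -> 1 <= c -> 1 <= m -> m <= 2 * N%:R + c - 1 ->
  `|e| <= m / (2 * N%:R + c - m) ->
  `|m ^- (2 * s).+1 * e| <= N%:R^-1 * (m ^- 2 + N%:R^-1).
Proof.
move=> s0 N0 c1 m1 mN he; have s2 : (2 <= 2 * s)%N by lia.
set L := 2 * N%:R + c in mN he *.
have NR0 : 1 <= N%:R :> R by rewrite ler1n.
have m0 : 0 < m by lra.
have Lm0 : 0 < L - m by lra.
have L0 : 0 < L by lra.
have mi0 : 0 < m^-1 by rewrite invr_gt0.
have mi1 : m^-1 <= 1 by rewrite invf_le1.
have Li0 : 0 < L^-1 by rewrite invr_gt0.
have Ni0 : 0 < N%:R^-1 :> R by rewrite invr_gt0; lra.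
have LN : L^-1 <= N%:R^-1 by rewrite lef_pV2 ?posrE //; rewrite /L; lra.
have pf : m ^- 2 / (L - m) = L^-1 * (m ^- 2 + (m * (L - m))^-1).
  by field; rewrite !gt_eqF.
have hm : (m * (L - m))^-1 <= N%:R^-1.
  rewrite lef_pV2 ?posrE ?mulr_gt0 //; last lra.
  (* This product equals [m * (L - m) - (L - 1)], so [m * (L - m)] is at least [L - 1], hence at
     least [N]. *)
  have : 0 <= (m - 1) * (L - 1 - m) by apply: mulr_ge0; lra.
  rewrite /L; nra.
apply: (@le_trans _ _ (m ^- 2 / (L - m))).
  have mS0 : 0 <= m ^- (2 * s).+1 by rewrite invr_ge0 exprn_ge0 // ltW.
  rewrite normrM (ger0_norm mS0).
  apply: (@le_trans _ _ (m ^- (2 * s).+1 * (m / (L - m)))).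
    by rewrite ler_wpM2l.
  rewrite mulrA ler_wpM2r ?invr_ge0 ?(ltW Lm0) //.
  rewrite exprS invfM mulrAC mulVf ?gt_eqF // mul1r.
  rewrite lef_pV2 ?posrE ?exprn_gt0 //.
  exact: ler_weXn2l.
rewrite pf ler_pM ?(ltW Li0) //.
  by rewrite ltW // addr_gt0 ?invr_gt0 ?exprn_gt0 ?mulr_gt0.
by rewrite lerD2l.
Qed.

Lemma convolution_error (R : realType) (s N : nat) : (0 < s)%N -> (0 < N)%N ->
  `|2 * (\sum_(k < s) even_sum R (2 * (s - k)) N * odd_sum R (2 * k.+1) N)
     - odd_sum R (2 * s).+2 N|
   <= N%:R^-1 * (even_sum R 2 N + odd_sum R 2 N + 2).
Proof.
move=> s0 N0; rewrite even_odd_convolution -addrA -sumrB.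
have NN : N%:R != 0 :> R by rewrite pnatr_eq0 -lt0n.
(* The constant 2 collects [N%:R^-1] from the [N] even and the [N] odd terms. *)
have -> : even_sum R 2 N + odd_sum R 2 N + 2 =
  \sum_(i < N) ((2 * i%:R + 2) ^- 2 + N%:R^-1) +
  \sum_(j < N) ((2 * j%:R + 1) ^- 2 + N%:R^-1) :> R.
  rewrite !big_split /= !sumr_const card_ord.
  have -> : N%:R^-1 *+ N = 1 :> R by rewrite -[LHS]mulr_natl mulfV.
  rewrite /even_sum /odd_sum; ring.
rewrite mulrDr; apply: (le_trans (ler_normD _ _)); apply: lerD; rewrite mulr_sumr;
  apply: (le_trans (ler_norm_sum _ _ _)); apply: ler_sum => i _.
- have iN : i.+1%:R <= N%:R :> R by rewrite ler_nat.
  have i0 : 0 <= i%:R :> R by [].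
  move: iN (pf_sum_odd_bound R (ltn_ord i)); rewrite -(@natr1 R i).
  have -> : 2 * (i%:R + 1) = 2 * i%:R + 2 :> R by ring.
  by move=> iN h; apply: (@weighted_error_bound _ _ _ 1) => //; lra.
- have iN : i.+1%:R <= N%:R :> R by rewrite ler_nat.
  have i0 : 0 <= i%:R :> R by [].
  (* The limit [n^-1] of the inner sum, with weight [n ^- (2 * s).+1], is the term of [odd_sum] at
     exponent [2 * s + 2]. *)
  rewrite [_ ^+ (2 * s).+2]exprSr invfM -mulrBr.
  move: iN (pf_sum_even_bound R (ltn_ord i)); rewrite -(@natr1 R i) => iN h.
  by apply: (@weighted_error_bound _ _ _ 2) => //; lra.
Qed.

(** * The value of theta at 2 *)

Lemma sin_le_id (R : realType) (x : R) : 0 < x < pi / 2 -> sin x <= x.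
Proof.
move=> /andP[x0 x1].
have [c _] := @MVT R sin cos 0 x x0 (fun c _ => is_derive_sin c)
  (continuous_subspaceT (@continuous_sin R)).
rewrite sin0 !subr0 => ->.
by rewrite ler_piMl // ?cos_le1 // ltW.
Qed.

(** This is [x <= tan x], from the mean value theorem, since the derivative [cos c ^- 2] of [tan] is
    at least 1. *)
Lemma mul_cos_le_sin (R : realType) (x : R) : 0 < x < pi / 2 -> x * cos x <= sin x.
Proof.
move=> /andP[x0 x1].
have cos_pos (c : R) : 0 <= c -> c < pi / 2 -> 0 < cos c.
  by move=> c0 c1; rewrite cos_gt0_pihalf // c1 andbT; have := pi_gt0 R; lra.
have [||c /[!in_itv]/= /andP[c0 c1]] := @MVT R tan (fun c => cos c ^- 2) 0 x x0.
- move=> c /[!in_itv]/= /andP[c0 c1]; apply: is_derive_tan.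
  by rewrite gt_eqF // cos_pos // ?(ltW c0) // (lt_trans c1).
- apply: derivable_within_continuous => c /[!in_itv]/= /andP[c0 c1].
  apply: derivable_tan; rewrite gt_eqF // cos_pos // (le_lt_trans c1) //.
rewrite tan0 !subr0 => tanx.
have cx : 0 < cos x by rewrite cos_pos // ltW.
have cc : 0 < cos c by rewrite cos_pos // ?(ltW c0) // (lt_trans c1).
rewrite -ler_pdivlMr // -/(tan x) tanx ler_peMl ?(ltW x0) //.
by rewrite invf_ge1 ?exprn_gt0 // exprn_ile1 ?cos_le1 // ltW.
Qed.

Lemma inv_sqr_sin_bounds (R : realType) (x : R) : 0 < x < pi / 2 ->
  sin x ^- 2 - 1 <= x ^- 2 <= sin x ^- 2.
Proof.
move=> hx; have /andP[x0 x1] := hx.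
have s0 := sin_gt0_pihalf hx.
have c0 : 0 < cos x by rewrite cos_gt0_pihalf // x1 andbT; lra.
apply/andP; split; last first.
  rewrite lef_pV2 ?posrE ?exprn_gt0 //.
  by rewrite ler_pXn2r ?nnegrE ?(ltW s0) ?(ltW x0) // sin_le_id.
(* The left-hand side is the squared cotangent, so the bound reduces to [x * cos x <= sin x]. *)
have -> : sin x ^- 2 - 1 = (cos x / sin x) ^+ 2.
  rewrite expr_div_n cos2sin2; field; exact: lt0r_neq0.
rewrite -exprVn ler_pXn2r ?nnegrE ?divr_ge0 ?invr_ge0 ?(ltW s0) ?(ltW x0) ?(ltW c0) //.
by rewrite ler_pdivrMr // mulrC ler_pdivlMr // mulrC mul_cos_le_sin.
Qed.

(** For [k < 2 ^ n], the angles reached from [pi / 4] after [n] rounds of replacing [x] by [x / 2]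
    and [pi / 2 - x / 2]. *)
Definition dyadic_angle (R : realType) (n k : nat) : R :=
  (2 * k%:R + 1) * pi / 2 ^+ n.+2.

Lemma dyadic_angle_bounds (R : realType) (n k : nat) : (k < 2 ^ n)%N ->
  0 < dyadic_angle R n k < pi / 2.
Proof.
move=> kn; have pi0 := pi_gt0 R.
have p2 : 0 < 2 ^+ n.+2 :> R by rewrite exprn_gt0.
have k0 : 0 < 2 * k%:R + 1 :> R by rewrite ltr_wpDl // mulr_ge0.
rewrite /dyadic_angle; apply/andP; split; first by apply: divr_gt0 => //; apply: mulr_gt0.
rewrite ltr_pdivrMr // mulrC exprS mulrA divfK // ltr_pM2l //.
by rewrite -natrX -natrM natr1 ltr_nat expnS; lia.
Qed.

Lemma inv_sqr_sin_double (R : realType) (x : R) : sin (2 * x) != 0 ->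
  sin x ^- 2 + sin (pi / 2 - x) ^- 2 = 4 * sin (2 * x) ^- 2.
Proof.
have -> : sin (pi / 2 - x) = cos x by rewrite addrC sinDpihalf cosN.
rewrite mulr_natl sin_mulr2n mulrn_eq0 /= mulf_eq0 negb_or.
move=> /andP[c0 s0].
have := cos2Dsin2 x.
have -> : sin x ^- 2 + cos x ^- 2 = (cos x ^+ 2 + sin x ^+ 2) / (sin x * cos x) ^+ 2.
  by field; rewrite c0 s0.
by move=> ->; field; rewrite c0 s0.
Qed.

Lemma sum_inv_sqr_sin (R : realType) (n : nat) :
  \sum_(k < 2 ^ n) sin (dyadic_angle R n k) ^- 2 = 2 * 4 ^+ n.
Proof.
elim: n => [|n IHn].
  rewrite big_ord1 /dyadic_angle mulr0 add0r mul1r expr0 mulr1.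
  set y : R := pi / 2 ^+ 2.
  have e : y *+ 2 = pi / 2 by rewrite /y; field.
  have := cos_mulr2n y; rewrite e cos_pihalf => h.
  rewrite sin2cos2.
  have -> : cos y ^+ 2 = 2^-1 by lra.
  have -> : 1 - 2^-1 = 2^-1 :> R by lra.
  by rewrite invrK.
rewrite exprS mulrCA -IHn mulr_sumr.
have e2 : (2 ^ n.+1 = 2 ^ n + 2 ^ n)%N by rewrite expnS mul2n addnn.
rewrite -(big_mkord xpredT (fun k => sin (dyadic_angle R n.+1 k) ^- 2)) e2.
rewrite (big_cat_nat (n := (2 ^ n)%N)) ?leq_addr //=.
have -> : \sum_(2 ^ n <= k < 2 ^ n + 2 ^ n) sin (dyadic_angle R n.+1 k) ^- 2 =
    \sum_(0 <= k < 2 ^ n) sin (dyadic_angle R n.+1 (k + 2 ^ n)) ^- 2.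
  by rewrite -{1}[(2 ^ n)%N]add0n big_addn addnK.
(* Reversing the upper half pairs [k] with [2 ^ n.+1 - k.+1], whose angle is the complement to
   [pi / 2]; each pair merges into one angle of level [n]. *)
rewrite !big_mkord [X in _ + X](reindex_inj rev_ord_inj) /= -big_split.
apply: eq_bigr => k _ /=.
have -> : (2 ^ n - k.+1 + 2 ^ n = 2 ^ n.+1 - k.+1)%N by have := ltn_ord k; lia.
have p2 : 2 ^+ n != 0 :> R by rewrite expf_neq0.
have -> : dyadic_angle R n.+1 (2 ^ n.+1 - k.+1) = pi / 2 - dyadic_angle R n.+1 k.
  rewrite /dyadic_angle natrB; last by rewrite e2; have := ltn_ord k; lia.
  rewrite natrX -[k.+1%:R]natr1 !exprS; field.
  by [].
have e : dyadic_angle R n k = 2 * dyadic_angle R n.+1 k.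
  by rewrite /dyadic_angle !exprS; field.
rewrite e inv_sqr_sin_double // -e gt_eqF //.
by apply: sin_gt0_pihalf; exact: dyadic_angle_bounds.
Qed.

(** Sums [inv_sqr_sin_bounds] over the angles: the slack of 1 per angle totals [2 ^ n] against
    [2 * 4 ^ n], a relative error of [2 ^- n.+1]. *)
Lemma odd_sum2_dyadic_bounds (R : realType) (n : nat) :
  pi ^+ 2 / 8 * (1 - 2 ^- n.+1) <= odd_sum R 2 (2 ^ n) <= pi ^+ 2 / 8.
Proof.
have p2 : 2 ^+ n != 0 :> R by rewrite expf_neq0.
have pi0 := pi_gt0 R.
have p4 : 4 ^+ n = 2 ^+ n * 2 ^+ n :> R by rewrite -exprMn; congr (_ ^+ _); ring.
have -> : odd_sum R 2 (2 ^ n) =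
    pi ^+ 2 / (16 * 4 ^+ n) * \sum_(k < 2 ^ n) dyadic_angle R n k ^- 2.
  rewrite /odd_sum mulr_sumr; apply: eq_bigr => k _.
  have k0 : 2 * k%:R + 1 != 0 :> R by rewrite gt_eqF // ltr_wpDl // mulr_ge0.
  rewrite /dyadic_angle p4 !exprS expr0; move: pi pi0 => p p0.
  by field; rewrite p2 k0 gt_eqF.
have c0 : 0 < pi ^+ 2 / (16 * 4 ^+ n) :> R.
  apply: divr_gt0; first exact: exprn_gt0.
  by apply: mulr_gt0 => //; exact: exprn_gt0.
have -> : pi ^+ 2 / 8 = pi ^+ 2 / (16 * 4 ^+ n) * (2 * 4 ^+ n) :> R.
  by rewrite p4; field.
rewrite -mulrA !ler_pM2l //.
have -> : 2 * 4 ^+ n * (1 - 2 ^- n.+1) =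
   \sum_(k < 2 ^ n) (sin (dyadic_angle R n k) ^- 2 - 1).
  rewrite sumrB sum_inv_sqr_sin sumr_const card_ord natrX p4 exprS; field.
  by [].
by apply/andP; split; rewrite -?sum_inv_sqr_sin; apply: ler_sum => k _;
  have /inv_sqr_sin_bounds/andP[] := dyadic_angle_bounds R (ltn_ord k).
Qed.

(** * Passage to the limit *)

Lemma nondecreasing_odd_sum (R : realType) (m : nat) :
  {homo odd_sum R m : N N' / (N <= N')%N >-> N <= N'}.
Proof.
apply: homo_leq => [x //|y x z|N]; first exact: le_trans.
by rewrite /odd_sum big_ord_recr lerDl invr_ge0 exprn_ge0 // addr_ge0 // mulr_ge0.
Qed.

Lemma nondecreasing_even_sum (R : realType) (m : nat) :
  {homo even_sum R m : N N' / (N <= N')%N >-> N <= N'}.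
Proof.
apply: homo_leq => [x //|y x z|N]; first exact: le_trans.
by rewrite /even_sum big_ord_recr lerDl invr_ge0 exprn_ge0 // addr_ge0 // mulr_ge0.
Qed.

Lemma odd_sum_le (R : realType) (m N : nat) : (2 <= m)%N ->
  odd_sum R m N <= pi ^+ 2 / 8.
Proof.
move=> m2; apply: (@le_trans _ _ (odd_sum R 2 N)).
  apply: ler_sum => j _.
  have j1 : 1 <= 2 * j%:R + 1 :> R by rewrite lerDr mulr_ge0.
  have j0 : 0 < 2 * j%:R + 1 :> R by apply: lt_le_trans j1.
  rewrite lef_pV2 ?posrE ?exprn_gt0 //; exact: ler_weXn2l.
(* The bound is known at powers of 2 only, and monotonicity carries it to [N]. *)
apply: (@le_trans _ _ (odd_sum R 2 (2 ^ N))).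
  by apply: nondecreasing_odd_sum; rewrite ltnW // ltn_expl.
by have /andP[] := odd_sum2_dyadic_bounds R N.
Qed.

Lemma even_sum_le (R : realType) (m N : nat) : (2 <= m)%N ->
  even_sum R m N <= pi ^+ 2 / 8.
Proof.
move=> m2; apply: le_trans (odd_sum_le R N m2); apply: ler_sum => j _.
have j0 : 0 <= j%:R :> R by [].
rewrite lef_pV2 ?posrE ?exprn_gt0 //; try lra.
by rewrite ler_pXn2r ?nnegrE //; try lra; lia.
Qed.

Lemma is_cvg_odd_sum (R : realType) (m : nat) : (2 <= m)%N -> cvgn (odd_sum R m).
Proof.
move=> m2; apply: nondecreasing_is_cvgn; first exact: nondecreasing_odd_sum.
by exists (pi ^+ 2 / 8) => _ [N _ <-]; exact: odd_sum_le.
Qed.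

Lemma is_cvg_even_sum (R : realType) (m : nat) : (2 <= m)%N -> cvgn (even_sum R m).
Proof.
move=> m2; apply: nondecreasing_is_cvgn; first exact: nondecreasing_even_sum.
by exists (pi ^+ 2 / 8) => _ [N _ <-]; exact: even_sum_le.
Qed.

Definition zeta_sum (R : realType) (m N : nat) : R :=
  \sum_(1 <= n < N.+1) n%:R ^- m.

Lemma even_sum_zeta_sum (R : realType) (m N : nat) :
  even_sum R m N = 2 ^- m * zeta_sum R m N.
Proof.
rewrite /zeta_sum big_add1 big_mkord mulr_sumr; apply: eq_bigr => i _.
by rewrite -invfM -exprMn -(@natr1 R i) mulrDr mulr1.
Qed.

Lemma zeta_sum_double (R : realType) (m N : nat) :
  zeta_sum R m (2 * N) = odd_sum R m N + even_sum R m N.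
Proof.
elim: N => [|N IHN]; first
  by rewrite muln0 /zeta_sum big_geq // /odd_sum /even_sum !big_ord0 addr0.
rewrite mulnS /zeta_sum /= add2n 2?big_nat_recr //= -/(zeta_sum R m (2 * N)) IHN.
rewrite /odd_sum /even_sum !big_ord_recr /=.
have -> : (2 * N).+1%:R = 2 * N%:R + 1 :> R by rewrite -natr1 natrM.
have -> : (2 * N).+2%:R = 2 * N%:R + 2 :> R by rewrite -addn2 natrD natrM.
ring.
Qed.

Lemma zetaE (R : realType) (m : nat) : zeta (m%:R : R) = limn (zeta_sum R m).
Proof.
rewrite /zeta (_ : (fun N => _) = zeta_sum R m) //; apply/funext => N.
by apply: eq_bigr => n _; rewrite powRN powR_mulrn.
Qed.

Lemma powR2N (R : realType) (m : nat) : 2 `^ (- m%:R) = 2 ^- m :> R.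
Proof. by rewrite powRN powR_mulrn. Qed.

(** Since [zeta] is a [limn], convergence has to be supplied; it comes from the bounded even sums,
    which are [2 ^- m] times the full ones. *)
Lemma cvg_zeta_sum (R : realType) (m : nat) : (2 <= m)%N ->
  (zeta_sum R m @ \oo --> zeta (m%:R : R))%classic.
Proof.
move=> m2; rewrite zetaE.
have -> : zeta_sum R m = (fun N => 2 ^+ m * even_sum R m N).
  by apply/funext => N; rewrite even_sum_zeta_sum mulVKf // expf_neq0.
have h : (2 ^+ m * even_sum R m N @[N --> \oo] --> 2 ^+ m * limn (even_sum R m))%classic.
  by apply: cvgMl_tmp; exact: is_cvg_even_sum.
by rewrite (cvg_lim _ h).
Qed.

Lemma cvg_even_sum (R : realType) (m : nat) : (2 <= m)%N ->
  (even_sum R m @ \oo --> phi (m%:R : R))%classic.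
Proof.
move=> m2; rewrite /phi powR2N.
have -> : even_sum R m = (fun N => 2 ^- m * zeta_sum R m N).
  by apply/funext => N; rewrite even_sum_zeta_sum.
by apply: cvgMl_tmp; exact: cvg_zeta_sum.
Qed.

(** The odd terms are the first [2 * N] terms of the zeta series minus the even ones. *)
Lemma cvg_odd_sum (R : realType) (m : nat) : (2 <= m)%N ->
  (odd_sum R m @ \oo --> theta (m%:R : R))%classic.
Proof.
move=> m2.
have -> : odd_sum R m = (fun N => zeta_sum R m (2 * N) - even_sum R m N).
  by apply/funext => N; rewrite zeta_sum_double addrK.
have -> : theta (m%:R : R) = zeta (m%:R : R) - phi (m%:R : R).
  by rewrite /theta /phi mulrBl mul1r.
apply: cvgB; last exact: cvg_even_sum.
apply: (@cvg_comp _ _ _ (muln 2) (zeta_sum R m) _ \oo%classic); last exact: cvg_zeta_sum.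
exact: cvg_mulnl.
Qed.

Lemma theta2 (R : realType) : theta (2%:R : R) = pi ^+ 2 / 8.
Proof.
have c := @cvg_odd_sum R 2 isT.
apply/eqP; rewrite eq_le; apply/andP; split.
  by apply: (cvgr_to_le c); apply: nearW => N; exact: odd_sum_le.
have low n : pi ^+ 2 / 8 * (1 - 2^-1 ^+ n.+1) <= theta (2%:R : R).
  rewrite exprVn; have /andP[h _] := odd_sum2_dyadic_bounds R n.
  apply: (le_trans h); rewrite -(cvg_lim _ c) //.
  by apply: nondecreasing_cvgn_le; [exact: nondecreasing_odd_sum | exact: is_cvg_odd_sum].
have c2 : (pi ^+ 2 / 8 * (1 - 2^-1 ^+ n.+1) @[n --> \oo] -->
    (pi ^+ 2 / 8 * (1 - 0) : R))%classic.
  apply: cvgMl_tmp; apply: cvgB; first exact: cvg_cst.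
  rewrite (@cvg_shiftS R (fun n => 2^-1 ^+ n : R)); apply: cvg_expr.
  by rewrite ger0_norm ?invf_lt1 ?ltr1n.
rewrite -[_ / 8]mulr1 -[X in _ * X]subr0.
by apply: (cvgr_to_le c2); apply: nearW.
Qed.

Lemma theta_rec (R : realType) (s : nat) : (0 < s)%N ->
  theta (2 * s + 2)%:R =
    2 * \sum_(k < s) phi (2 * (s - k))%:R * theta (2 * k.+1)%:R :> R.
Proof.
move=> s0.
have c1 : ((2 * \sum_(k < s) even_sum R (2 * (s - k)) N * odd_sum R (2 * k.+1) N)
    @[N --> \oo] -->
    (2 * \sum_(k < s) phi (2 * (s - k))%:R * theta (2 * k.+1)%:R : R))%classic.
  apply: cvgMl_tmp; apply: cvg_big => [|k _]; first exact: add_continuous.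
  by apply: cvgM; [apply: cvg_even_sum; have := ltn_ord k; lia | apply: cvg_odd_sum; lia].
have c2 : (odd_sum R (2 * s).+2 @ \oo --> theta ((2 * s + 2)%:R : R))%classic.
  by rewrite addn2; exact: cvg_odd_sum.
(* The index is shifted to [N.+1] because [convolution_error] asks for a positive truncation. *)
have c3 : (N.+1%:R^-1 * (even_sum R 2 N.+1 + odd_sum R 2 N.+1 + 2)
    @[N --> \oo] --> (0 : R))%classic.
  rewrite -[0](mul0r (phi 2%:R + theta 2%:R + 2)).
  apply: cvgM; first exact: cvg_harmonic.
  apply: cvgD; last exact: cvg_cst.
  by apply: cvgD; rewrite cvg_shiftS; [exact: cvg_even_sum | exact: cvg_odd_sum].
apply/esym/eqP; rewrite -subr_eq0; apply/eqP.
have c4 : (2 * (\sum_(k < s) even_sum R (2 * (s - k)) N * odd_sum R (2 * k.+1) N)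
    - odd_sum R (2 * s).+2 N @[N --> \oo] -->
    (2 * (\sum_(k < s) phi (2 * (s - k))%:R * theta (2 * k.+1)%:R)
      - theta (2 * s + 2)%:R : R))%classic.
  exact: cvgB.
rewrite -(cvg_lim (@Rhausdorff R) c4); apply: (cvg_lim (@Rhausdorff R)).
apply/norm_cvg0P; rewrite -cvg_shiftS /=.
apply: (squeeze_cvgr _ (cvg_cst 0) c3); apply: nearW => N.
by rewrite normr_ge0 /= convolution_error.
Qed.

(** * Renewal recurrences and their solutions *)

Lemma renewal_uniq (R : comNzRingType) (a x y : nat -> R) :
  x 0%N = y 0%N ->
  (forall n, x n.+1 = \sum_(l < n.+1) a l.+1 * x (n - l)%N) ->
  (forall n, y n.+1 = \sum_(l < n.+1) a l.+1 * y (n - l)%N) ->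
  x =1 y.
Proof.
move=> xy0 hx hy n; elim/ltn_ind: n => -[|n] IHn //.
rewrite hx hy; apply: eq_bigr => l _; rewrite IHn // ltnS; exact: leq_subr.
Qed.

(** The alternating signs of [h] cancel against [(-1) ^+ n], leaving a recurrence with coefficients
    [2 * a k]. *)
Lemma signed_Delta_rec (R : realType) (a h : nat -> R) (n : nat) :
  (forall k, (1 <= k)%N -> h k = 2 * (-1) ^+ (k - 1) * a k) ->
  (-1) ^+ n.+1 * Delta n.+1 h =
  \sum_(l < n.+1) 2 * a l.+1 * ((-1) ^+ (n - l) * Delta (n - l) h).
Proof.
move=> hh; rewrite Delta_rec exprS mulN1r mulrNN mulr_sumr; apply: eq_bigr => l _.
have le_ln : (l <= n)%N by rewrite -ltnS.
have -> : (-1) ^+ n = (-1) ^+ (n - l) * (-1) ^+ l :> R by rewrite -exprD subnK.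
rewrite hh // subn1 /=.
set x := (-1) ^+ (n - l); set D := Delta _ _.
have e : (-1) ^+ l * (-1) ^+ l = 1 :> R by rewrite -exprMn mulrNN mulr1 expr1n.
move: e; set y := (-1) ^+ l => e.
by transitivity (y * y * (2 * a l.+1 * (x * D))); [ring | rewrite e mul1r].
Qed.

Lemma renewal_solutions (R : realType) (a h c : nat -> R) (s : nat) :
  (forall k, (1 <= k)%N -> h k = 2 * (-1) ^+ (k - 1) * a k) ->
  (forall n, c n.+1 = \sum_(l < n.+1) 2 * a l.+1 * c (n - l)%N) ->
  (1 <= s)%N ->
  c s = (-1) ^+ s * c 0%N * Delta s h /\
  c s = c 0%N *
    \sum_(1 <= t < s.+1) \sum_(d in weighted_compositions s t)
       2 ^+ t * multinom R t (fun i : 'I_s => d i) *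
       \prod_(i < s) a i.+1 ^+ d i.
Proof.
(* [b] is the solution normalized to [b 0 = 1]; by uniqueness [c] is [c 0] times it. *)
move=> hh hc s1; pose b n := (-1) ^+ n * Delta n h.
have b0 : b 0%N = 1 by rewrite /b /Delta det_mx00 !expr0 !mulr1.
have hb n : b n.+1 = \sum_(l < n.+1) 2 * a l.+1 * b (n - l)%N.
  exact: signed_Delta_rec.
have cb : c s = c 0%N * b s.
  move: s {s1}; apply: (@renewal_uniq _ (fun k => 2 * a k)) => [|n|n].
  - by rewrite b0 mulr1.
  - exact: hc.
  - by rewrite hb mulr_sumr; apply: eq_bigr => l _; rewrite mulrCA.
split; first by rewrite cb /b mulrA [c 0%N * _]mulrC.
by rewrite (sum_weighted_compositions b0 hb s1).
Qed.

Lemma theta_renewal (R : realType) (n : nat) :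
  theta (2 * n.+1 + 2)%:R =
  \sum_(l < n.+1) 2 * phi (2 * l.+1)%:R * theta (2 * (n - l) + 2)%:R :> R.
Proof.
rewrite theta_rec // mulr_sumr (reindex_inj rev_ord_inj); apply: eq_bigr => l _ /=.
have le_ln : (l <= n)%N by rewrite -ltnS.
rewrite -mulrA; congr (_ * (phi _%:R * theta _%:R)); lia.
Qed.

Lemma theta_zeta (R : realType) (n : nat) :
  (2 ^+ n - 1) * zeta n%:R = 2 ^+ n * theta n%:R :> R.
Proof.
rewrite /theta powR2N mulrA mulrBr mulr1 mulfV // expf_neq0 //.
Qed.

(** [theta_renewal] multiplied by [2 ^+ (2 * n.+1 + 2)]: this power splits into one factor turning
    [phi] into [zeta] and one rescaling [theta]. *)
Lemma zeta_renewal (R : realType) (n : nat) :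
  (2 ^+ (2 * n.+1 + 2) - 1) * zeta (2 * n.+1 + 2)%:R =
  \sum_(l < n.+1) 2 * zeta (2 * l.+1)%:R *
     ((2 ^+ (2 * (n - l) + 2) - 1) * zeta (2 * (n - l) + 2)%:R) :> R.
Proof.
rewrite theta_zeta theta_renewal mulr_sumr; apply: eq_bigr => l _.
have le_ln : (l <= n)%N by rewrite -ltnS.
rewrite theta_zeta /phi powR2N.
have -> : (2 * n.+1 + 2 = 2 * l.+1 + (2 * (n - l) + 2))%N by lia.
rewrite exprD.
have p2 : 2 ^+ (2 * l.+1) != 0 :> R by rewrite expf_neq0.
move: (2 ^+ (2 * l.+1)) p2 => x x0; move: (2 ^+ _) => y.
move: (zeta _) (theta _) => z t.
by field.
Qed.

Theorem theorem1p3 (R : realType) (p q : nat -> R)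
  (hp : forall k : nat, (1 <= k)%N ->
          p k = 2 * (-1) ^+ (k - 1) * phi (2 * k)%:R)
  (hq : forall k : nat, (1 <= k)%N ->
          q k = 2 * (-1) ^+ (k - 1) * zeta (2 * k)%:R)
  (s : nat) (hs : (1 <= s)%N) :
  [/\ theta (2 * s + 2)%:R =
        2 * \sum_(0 <= k < s)
              phi (2 * s - 2 * k)%:R * theta (2 * k + 2)%:R :> R,
      theta (2 * s + 2)%:R = (-1) ^+ s * pi ^+ 2 / 8 * Delta s p
    & theta (2 * s + 2)%:R =
        pi ^+ 2 / 8 *
        \sum_(1 <= t < s.+1) \sum_(d in weighted_compositions s t)
          2 ^+ t * multinom R t (fun i : 'I_s => d i) *
          \prod_(i < s) phi (2 * i.+1)%:R ^+ d i :> R]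
  /\
  [/\ zeta (2 * s + 2)%:R =
        2 / (2 ^+ (2 * s + 2) - 1) *
        \sum_(0 <= k < s)
          (2 ^+ (2 * k + 2) - 1) * zeta (2 * s - 2 * k)%:R
            * zeta (2 * k + 2)%:R :> R,
      zeta (2 * s + 2)%:R =
        (-1) ^+ s * pi ^+ 2 / (2 * (2 ^+ (2 * s + 2) - 1)) * Delta s q
    & zeta (2 * s + 2)%:R =
        (pi ^+ 2 / 2) / (2 ^+ (2 * s + 2) - 1) *
        \sum_(1 <= t < s.+1) \sum_(d in weighted_compositions s t)
          2 ^+ t * multinom R t (fun i : 'I_s => d i) *
          \prod_(i < s) zeta (2 * i.+1)%:R ^+ d i :> R].
Proof.
have [th1 th2] := renewal_solutions (a := fun k => phi (2 * k)%:R)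
  (c := fun k => theta (2 * k + 2)%:R) hp (@theta_renewal R) hs.
have [ze1 ze2] := renewal_solutions (a := fun k => zeta (2 * k)%:R)
  (c := fun k => (2 ^+ (2 * k + 2) - 1) * zeta (2 * k + 2)%:R)
  hq (@zeta_renewal R) hs.
(* The initial values are [theta 2 = pi ^+ 2 / 8] and [(2 ^+ 2 - 1) * zeta 2 = 2 ^+ 2 * theta 2],
   that is [pi ^+ 2 / 2]. *)
move: th1 th2 ze1 ze2; rewrite muln0 add0n (theta_zeta R 2) theta2 => th1 th2 ze1 ze2.
have d0 : 2 ^+ (2 * s + 2) - 1 != 0 :> R.
  by rewrite subr_eq0 gt_eqF // exprn_egt1 ?ltr1n // addn2.
have ze x : (2 ^+ (2 * s + 2) - 1) * zeta (2 * s + 2)%:R = x ->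
    zeta (2 * s + 2)%:R = (2 ^+ (2 * s + 2) - 1)^-1 * x :> R.
  by move=> <-; rewrite mulKf.
split; split.
- rewrite theta_rec // big_mkord; congr (_ * _); apply: eq_bigr => k _.
  by rewrite -mulnBr mulnS addnC.
- by rewrite th1 !mulrA.
- exact: th2.
- rewrite (ze _ (theta_zeta _ _)) theta_rec //.
  have -> : \sum_(0 <= k < s) (2 ^+ (2 * k + 2) - 1) * zeta (2 * s - 2 * k)%:R
        * zeta (2 * k + 2)%:R =
      2 ^+ (2 * s + 2) * \sum_(k < s) phi (2 * (s - k))%:R * theta (2 * k.+1)%:R :> R.
    rewrite big_mkord mulr_sumr; apply: eq_bigr => k _.
    rewrite -mulnBr mulrAC [(2 * k + 2)%N]addnC -mulnS theta_zeta /phi powR2N.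
    (* The power is split so that one factor cancels the [2 ^- (2 * (s - k))] of [phi] and the other
       belongs to [theta]. *)
    have -> : (2 * s + 2 = 2 * (s - k) + 2 * k.+1)%N by have := ltn_ord k; lia.
    have p2 : 2 ^+ (2 * (s - k)) != 0 :> R by rewrite expf_neq0.
    rewrite exprD; move: (2 ^+ (2 * (s - k))) p2 => x x0; move: (2 ^+ _) => y.
    move: (zeta _) (theta _) => z t.
    by field.
  move: (\sum_(k < s) _) (2 ^+ (2 * s + 2)) (2 ^+ (2 * s + 2) - 1) => S P D.
  by ring.
- rewrite (ze _ ze1); move: (2 ^+ (2 * s + 2) - 1) d0 => D d0.
  by field.
- rewrite (ze _ ze2); set S := \sum_(1 <= t < _) _; move: S => S.
  move: (2 ^+ (2 * s + 2) - 1) d0 => D d0.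
  by field.
Qed.
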